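(* Let $\sigma_{**}$ be a matrix parameter (assigning to every square centered Gaussian random matrix $X$ a number $\sigma_{**}(X)\ge0$), and suppose that there are universal constants $C,\beta>0$ such that $$\mathbf{E}\|X\|\le C\sigma(X)+C\sigma_{**}(X)(\log d)^\beta$$ for every $d$ and every $d\times d$ centered Gaussian random matrix $X$. Then for any choice of a universal constant $C'$, at least one of the following four properties must fail: (1) $\sigma_{**}(X_1+X_2)\le C'\{\sigma_{**}(X_1)+\sigma_{**}(X_2)\}$ for all centered jointly Gaussian random matrices $X_1,X_2$ of the same dimension. (2) $\sigma_{**}(U^*XU)\le C'\sigma_{**}(X)$ for every centered Gaussian random matrix $X$ and every non-random unitary matrix $U$ of the same dimension. (3) $\sigma_{**}(X\otimes\mathbf{1}_N)\le C'\sigma_{**}(X)$ for every centered Gaussian random matrix $X$ and every $N\in\mathbb{N}$. (4) $\sigma_{**}(G^N)=o((\log N)^{-\beta})$ as $N\to\infty$, where $G^N$ is a standard Wigner matrix of dimension $N$.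
   Context: A centered Gaussian random matrix is a random matrix with centered jointly Gaussian entries, i.e. of the form $X=\sum_{i=1}^ng_iA_i$ with $A_i\in M_d(\mathbb{C})$ deterministic and $g_i$ i.i.d. standard real Gaussians. $\|\cdot\|$ is the operator norm and $\sigma(X)^2=\|\mathbf{E}X^*X\|\vee\|\mathbf{E}XX^*\|$ (which is $\|\mathbf{E}X^2\|$ for self-adjoint $X$). $\mathbf{1}_N$ is the identity of $M_N(\mathbb{C})$. A standard Wigner matrix of dimension $N$ is an $N\times N$ self-adjoint random matrix $G^N$ whose entries on and above the diagonal are independent real Gaussian variables with mean zero and variance $\frac1N$. A matrix parameter depends only on the distribution of the random matrix. *)

(* Defs.v *)
From HB Require Import structures.
From mathcomp Require Export all_boot all_order all_algebra.
From mathcomp Require Export mxtens complex.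
From mathcomp Require Export all_classical all_reals all_analysis.
Export numFieldNormedType.Exports.
Export Order.TTheory GRing.Theory Num.Theory.

Set Implicit Arguments.
Unset Strict Implicit.
Unset Printing Implicit Defensive.

Local Open Scope classical_set_scope.
Local Open Scope complex_scope.
Local Open Scope ring_scope.
Local Open Scope sesquilinear_scope.

Section matrices.
Context {R : realType}.

Definition l2norm d (x : 'cV[R[i]]_d) : R :=
  Num.sqrt (\sum_(i < d) ComplexField.Normc.normc (x i ord0) ^+ 2).

Definition opnorm d (A : 'M[R[i]]_d) : R :=
  sup [set l2norm (A *m x) | x in [set x : 'cV[R[i]]_d | l2norm x <= 1]].

(* The Borel sigma-algebra of M_d(C): the one generated by the real and
   imaginary parts of the entries. *)
Definition mx_borel d : set (set 'M[R[i]]_d) :=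
  <<s [set S | exists i j (B : set R), measurable B /\
        (S = [set A : 'M[R[i]]_d | B (complex.Re (A i j))] \/
         S = [set A : 'M[R[i]]_d | B (complex.Im (A i j))])] >>.

End matrices.

Section random_matrices.
Context {R : realType} {disp : measure_display} {T : measurableType disp}.
Variable P : probability T R.

Definition mutually_independent (I : finType) (D : {set I})
    (X : I -> T -> R) : Prop :=
  forall (J : {set I}) (B : I -> set R), J \subset D ->
    (forall i, i \in J -> measurable (B i)) ->
    P (\bigcap_(i in [set` J]) (X i @^-1` B i)) =
      (\prod_(i in J) P (X i @^-1` B i))%E.

(* [s] is the standard deviation, as in [normal_prob]. *)
Definition centered_normal (s : R) (X : T -> R) : Prop :=
  measurable_fun setT X /\
  forall B : set R, measurable B -> P (X @^-1` B) = normal_prob 0 s B.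

Definition iid_standard_gaussian n (g : 'I_n -> T -> R) : Prop :=
  (forall i, centered_normal 1 (g i)) /\
  mutually_independent [set: 'I_n]%SET g.

Definition gaussian_series n (g : 'I_n -> T -> R) d (A : 'I_n -> 'M[R[i]]_d) :
    T -> 'M[R[i]]_d :=
  fun w => \sum_(k < n) (g k w)%:C *: A k.

Definition centered_gaussian_mx d (X : T -> 'M[R[i]]_d) : Prop :=
  exists n (g : 'I_n -> T -> R) (A : 'I_n -> 'M[R[i]]_d),
    iid_standard_gaussian g /\ X = gaussian_series g A.

(* Joint Gaussianity: both matrices are driven by the same Gaussians. *)
Definition centered_jointly_gaussian_mx d (X1 X2 : T -> 'M[R[i]]_d) : Prop :=
  exists n (g : 'I_n -> T -> R) (A1 A2 : 'I_n -> 'M[R[i]]_d),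
    [/\ iid_standard_gaussian g, X1 = gaussian_series g A1
      & X2 = gaussian_series g A2].

Definition mx_expectation d (X : T -> 'M[R[i]]_d) : 'M[R[i]]_d :=
  \matrix_(i, j) (fine 'E_P[fun w => complex.Re (X w i j)] +i*
                  fine 'E_P[fun w => complex.Im (X w i j)]).

Definition mx_sigma d (X : T -> 'M[R[i]]_d) : R :=
  Num.sqrt (Num.max
    (opnorm (mx_expectation (fun w => (X w)^t* *m X w)))
    (opnorm (mx_expectation (fun w => X w *m (X w)^t*)))).

Definition standard_wigner N (G : T -> 'M[R[i]]_N) : Prop :=
  [/\ forall w, (G w)^t* = G w,
      forall w i j, complex.Im (G w i j) = 0,
      forall i j : 'I_N, (i <= j)%N ->
        centered_normal (Num.sqrt (N%:R^-1)) (fun w => complex.Re (G w i j))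
    & mutually_independent [set p : 'I_N * 'I_N | (p.1 <= p.2)%N]%SET
        (fun p w => complex.Re (G w p.1 p.2))].

End random_matrices.

Definition same_distribution (R : realType) d
    (disp1 : measure_display) (T1 : measurableType disp1)
    (P1 : probability T1 R) (X1 : T1 -> 'M[R[i]]_d)
    (disp2 : measure_display) (T2 : measurableType disp2)
    (P2 : probability T2 R) (X2 : T2 -> 'M[R[i]]_d) : Prop :=
  forall S : set 'M[R[i]]_d, mx_borel S -> P1 (X1 @^-1` S) = P2 (X2 @^-1` S).

(* Arbitrary values are allowed on matrices that are not centered Gaussian. *)
Definition mx_functional (R : realType) :=
  forall (d : nat) (disp : measure_display) (T : measurableType disp)
    (P : probability T R), (T -> 'M[R[i]]_d) -> R.

Definition matrix_parameter (R : realType) (s : mx_functional R) : Prop :=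
  (forall (d : nat) (disp : measure_display) (T : measurableType disp)
     (P : probability T R) (X : T -> 'M[R[i]]_d), (0 < d)%N ->
     centered_gaussian_mx P X -> 0 <= s d disp T P X) /\
  (forall (d : nat)
     (disp1 : measure_display) (T1 : measurableType disp1)
     (P1 : probability T1 R) (X1 : T1 -> 'M[R[i]]_d)
     (disp2 : measure_display) (T2 : measurableType disp2)
     (P2 : probability T2 R) (X2 : T2 -> 'M[R[i]]_d), (0 < d)%N ->
     centered_gaussian_mx P1 X1 -> centered_gaussian_mx P2 X2 ->
     same_distribution P1 X1 P2 X2 ->
     s d disp1 T1 P1 X1 = s d disp2 T2 P2 X2).

(* Main.v *)
From mathcomp Require Import fingroup perm.
Require Import Defs.
From mathcomp Require Import measurable_realfun ring lra.

Set Implicit Arguments.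
Unset Strict Implicit.
Unset Printing Implicit Defensive.

Local Open Scope classical_set_scope.
Local Open Scope complex_scope.
Local Open Scope ring_scope.
Local Open Scope sesquilinear_scope.

(** Suppose that all four properties hold.  Let [G_0, ..., G_m] be independent
    standard Wigner matrices of dimension [N], and let [X] act on the [m + 1]-fold
    tensor power of [C^N] as the sum of the [G_i], the [i]-th one acting on the
    [i]-th tensor factor.  The four properties and the assumed bound contradict
    each other on [X] when [m] is large and [N] is then chosen large.

    - The parameter of [X] is small.  Up to tensoring with an identity and
      exchanging tensor factors (a unitary conjugation), [X] is a sum of [m + 1]
      Wigner matrices, so (1)-(3) bound its parameter by [K_m] times that of the
      [G_i], which is [o((log N)^-beta)] by (4).  Since the dimension of [X] is
      [N^(m+1)], the logarithm of the dimension is still of order [log N] and the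
      second term of the assumed bound tends to zero ([tensor_tower]).
    - The first term is of order [sqrt m]: by independence [E X^2] is a multiple
      of [m + 1] times the identity ([mx_sigma_gaussian_series]).
    - The norm is of order [m], because spectra add up under tensor sums.  The
      quadratic form of [X] at a product of unit vectors [v_i] is the sum of the
      quadratic forms of the [G_i] at the [v_i].  Let [v_i] have half of its mass
      at a coordinate [a0] and spread the other half over the remaining
      coordinates, with the signs of the row [a0] of [G_i].  Then the row and
      column [a0] contribute the absolute values of their entries, while every
      other entry is independent of the signs that multiply it and has mean zero;
      the expectation is thus at least half of the first absolute moment of the
      standard normal law, uniformly in [N] ([test_value_mean]).

    Everything is computed on a product probability space, on which the
    expectation of a product of functions of the distinct coordinates is the
    product of the expectations ([gaussian_space]).  The absolute moments
    involved are kept symbolic: only the finiteness of the second moment and the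
    positivity of the first absolute moment matter. *)

(** * The normal law: scaling, symmetry and moments *)

Section normal_law.
Context {R : realType}.
Local Notation mu := (@lebesgue_measure R).
Local Open Scope ring_scope.

Lemma lebesgue_measure_dilation (c : {posnum R}) (A : set R) : measurable A ->
  mu A = (c%:num%:E * mu ([eta *%R c%:num] @^-1` A))%E.
Proof.
have mf : measurable_fun [set: R] ([eta *%R c%:num] : R -> measurableTypeR R).
  by apply: measurable_funM.
move=> mA.
have -> : (c%:num%:E * mu ([eta *%R c%:num] @^-1` A))%E = pushforward
  (mscale (c%:num%:nng)%R mu) ([eta *%R c%:num] : R -> measurableTypeR R) A by [].
apply: lebesgue_measure_unique => //= _ [[a b]] _ <-.
rewrite /mscale /pushforward.
have -> : [eta *%R c%:num] @^-1` `]a, b] = `]a / c%:num, b / c%:num]%classic.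
  apply/seteqP; split => x /=; rewrite !in_itv/=.
    by rewrite ltr_pdivrMr// ler_pdivlMr// [x * _]mulrC.
  by rewrite ltr_pdivrMr// ler_pdivlMr// [x * _]mulrC.
rewrite /= !lebesgue_measure_itv/= !lte_fin ltr_pM2r ?invr_gt0//.
case: ifP => _; last by rewrite mule0.
rewrite -!EFinB -mulrBl -EFinM; congr EFin; field; exact: lt0r_neq0.
Qed.

Lemma normal_pdf0E (s x : R) : s != 0 ->
  normal_pdf 0 s x = normal_peak s * expR (- x ^+ 2 / (s ^+ 2 *+ 2)).
Proof. by move=> s0; rewrite normal_pdfE// /normal_fun subr0. Qed.

(** If [Y] is standard normal, then [c Y] has standard deviation [c]. *)
Lemma normal_prob_dilation (c : {posnum R}) (B : set R) : measurable B ->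
  normal_prob 0 1 ([eta *%R c%:num] @^-1` B) = normal_prob 0 c%:num B.
Proof.
have mf : measurable_fun [set: R] ([eta *%R c%:num] : R -> measurableTypeR R).
  by apply: measurable_funM.
move=> mB; rewrite /normal_prob.
have mB' : measurable ([eta *%R c%:num] @^-1` B).
  by rewrite -[X in measurable X]setTI; exact: mf.
have -> : (\int[mu]_(x in B) (normal_pdf 0 c%:num x)%:E =
  \int[pushforward (mscale (c%:num%:nng)%R mu)
    ([eta *%R c%:num]%R : R -> measurableTypeR R)]_(x in B) (normal_pdf 0 c%:num x)%:E)%E.
  apply: eq_measure_integral => A mA _; exact: lebesgue_measure_dilation.
have mp : measurable_fun B (fun x : R => (normal_pdf 0 c%:num x)%:E).
  by apply/measurable_EFinP/measurable_funTS; exact: measurable_normal_pdf.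
rewrite ge0_integral_pushforward//=; last first.
  by move=> x _; rewrite lee_fin normal_pdf_ge0.
rewrite ge0_integral_mscale//=; last 2 first.
- apply/measurable_EFinP/measurable_funTS.
  by apply: measurableT_comp => //; exact: measurable_normal_pdf.
- by move=> x _; rewrite lee_fin normal_pdf_ge0.
rewrite -ge0_integralZl//=; last 2 first.
- apply/measurable_EFinP/measurable_funTS.
  by apply: measurableT_comp => //; exact: measurable_normal_pdf.
- by move=> x _; rewrite lee_fin normal_pdf_ge0.
apply: eq_integral => x _ /=; rewrite -EFinM; congr EFin.
rewrite !normal_pdf0E ?oner_neq0 ?lt0r_neq0//.
have k1 : 0 < c%:num by [].
set k := c%:num in k1 *; have k0 : k != 0 by rewrite lt0r_neq0.
change (normal_peak 1 * expR (- x ^+ 2 / (1 ^+ 2 *+ 2)) =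
  k * (normal_peak k * expR (- (k * x) ^+ 2 / (k ^+ 2 *+ 2)))).
have -> : - (k * x) ^+ 2 / (k ^+ 2 *+ 2) = - x ^+ 2 / (1 ^+ 2 *+ 2) by field.
rewrite mulrA; congr (_ * _).
rewrite /normal_peak expr1n mul1r -mulrnAr sqrtrM ?sqr_ge0// sqrtr_sqr gtr0_norm//.
by rewrite invfM mulrA divff// mul1r.
Qed.

Lemma normal_prob_opp (B : set R) : measurable B ->
  normal_prob 0 1 (-%R @^-1` B) = normal_prob 0 (1:R) B.
Proof.
move=> mB; rewrite /normal_prob.
have mB' : measurable (-%R @^-1` B).
  by rewrite -[X in measurable X]setTI; exact: (@oppr_measurable R setT).
have -> : (\int[mu]_(x in B) (normal_pdf 0 1 x)%:E =
  \int[pushforward mu (-%R : _ -> measurableTypeR R)]_(x in B) (normal_pdf 0 1 x)%:E)%E.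
  by apply: eq_measure_integral => A mA _; exact/esym/lebesgue_measureN.
rewrite ge0_integral_pushforward//=; last 2 first.
- by apply/measurable_EFinP/measurable_funTS; exact: measurable_normal_pdf.
- by move=> x _; rewrite lee_fin normal_pdf_ge0.
apply: eq_integral => x _ /=; congr EFin.
by rewrite !normal_pdf0E ?oner_neq0// sqrrN.
Qed.

(** Integration against the normal law is integration against its density. *)
Lemma ge0_integral_normal_prob (m s : R) (f : R -> \bar R) :
  measurable_fun setT f -> (forall x, 0 <= f x)%E ->
  (\int[normal_prob m s]_x f x = \int[mu]_x (f x * (normal_pdf m s x)%:E))%E.
Proof.
move=> mf f0.
have dom := @normal_prob_dominates R m s.
rewrite -(Radon_Nikodym_SigmaFinite.change_of_variables dom)//.
have mp : measurable_fun setT (fun x : R => (normal_pdf m s x)%:E).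
  by apply/measurable_EFinP; exact: measurable_normal_pdf.
have mg := measurable_int mu (Radon_Nikodym_SigmaFinite.f_integrable dom).
apply: ae_eq_integral => //.
- by apply: emeasurable_funM.
- by apply: emeasurable_funM.
apply: ae_eqe_mul2l => /=.
apply: integral_ae_eq => //=.
- exact: Radon_Nikodym_SigmaFinite.f_integrable.
- by move=> E _ mE; rewrite -Radon_Nikodym_SigmaFinite.f_integral.
Qed.

End normal_law.

Section normal_moments.
Context {R : realType}.
Local Notation mu := (@lebesgue_measure R).
Local Notation gam := (@normal_prob R 0 1).

Lemma integrable_sqr_normal : gam.-integrable setT (fun x : R => (x ^+ 2)%:E).
Proof.
have mf : measurable_fun [set: R] (fun x : R => (x ^+ 2)%:E).
  by apply/measurable_EFinP; exact: exprn_measurable.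
apply/integrableP; split => //.
under eq_integral do rewrite /= ger0_norm ?sqr_ge0//.
rewrite ge0_integral_normal_prob//; last by move=> x; rewrite lee_fin sqr_ge0.
set s : R := Num.sqrt 2.
have s0 : s != 0 by rewrite gt_eqF// sqrtr_gt0.
pose K : R := 4 * normal_peak 1 / normal_peak s.
apply: (@le_lt_trans _ _ (\int[mu]_x (K%:E * (normal_pdf 0 s x)%:E))%E); last first.
  by rewrite integralZl ?integral_normal_pdf ?mule1 ?ltry//; exact: integrable_normal_pdf.
have mp r : measurable_fun [set: R] (fun x : R => (normal_pdf 0 r x)%:E).
  by apply/measurable_EFinP; exact: measurable_normal_pdf.
apply: ge0_le_integral => //.
- by move=> x _; rewrite -EFinM lee_fin mulr_ge0 ?sqr_ge0 ?normal_pdf_ge0.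
- by apply: emeasurable_funM => //; exact: mp.
- by apply: measurable_funeM; exact: mp.
move=> x _; rewrite -!EFinM lee_fin !normal_pdf0E ?oner_neq0//.
(* As x ^ 2 <= 4 exp (x ^ 2 / 4), the integrand is at most a multiple of the
   density of standard deviation sqrt 2. *)
have -> : - x ^+ 2 / (1 ^+ 2 *+ 2) = - x ^+ 2 / 4 - x ^+ 2 / 4 by field.
have -> : - x ^+ 2 / (s ^+ 2 *+ 2) = - x ^+ 2 / 4.
  by rewrite /s sqr_sqrtr//; field.
rewrite expRD.
have -> : K * (normal_peak s * expR (- x ^+ 2 / 4)) =
    4 * (normal_peak 1 * expR (- x ^+ 2 / 4)).
  by rewrite /K; field; rewrite lt0r_neq0// normal_peak_gt0.
rewrite [leLHS]mulrCA [X in _ <= X]mulrCA ler_wpM2l ?normal_peak_ge0//.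
rewrite [leLHS]mulrCA mulrC ler_wpM2r ?expR_ge0//.
rewrite expRN ler_pdivrMr ?expR_gt0//.
have := expR_ge1Dx (x ^+ 2 / 4); lra.
Qed.

Lemma integrable_normal_le (f : R -> R) : measurable_fun setT f ->
  (forall x, `|f x| <= 1 + x ^+ 2) -> gam.-integrable setT (EFin \o f).
Proof.
move=> mf fle.
have i1 : gam.-integrable setT (fun x : R => (1 + x ^+ 2)%:E).
  rewrite (_ : (fun x => _) = (EFin \o cst 1) \+ (fun x : R => (x ^+ 2)%:E))//.
  apply: integrableD => //; last exact: integrable_sqr_normal.
  exact: finite_measure_integrable_cst.
apply: le_integrable i1 => //; first exact/measurable_EFinP.
by move=> x _ /=; rewrite lee_fin [leRHS]ger0_norm ?addr_ge0 ?sqr_ge0.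
Qed.

Lemma integral_odd_normal (f : R -> R) : gam.-integrable setT (EFin \o f) ->
  (forall x, f (- x) = - f x) -> (\int[gam]_x (f x)%:E = 0)%E.
Proof.
move=> fi odd.
have mN : measurable_fun [set: R] (-%R : R -> measurableTypeR R).
  exact: oppr_measurable.
have mf := measurable_int _ fi.
have eN : (EFin \o f) \o -%R = (fun x => - (EFin \o f) x)%E.
  by apply/funext => x /=; rewrite odd.
have E1 : (\int[gam]_x (f x)%:E = \int[gam]_x ((EFin \o f) \o -%R) x)%E.
  rewrite -[RHS](@integral_pushforward _ _ (measurableTypeR R)
    (measurableTypeR R) R _ mN gam setT (EFin \o f))//.
  - by apply: eq_measure_integral => A mA _; rewrite -[LHS]normal_prob_opp.
  - by rewrite preimage_setT eN; exact: integrableN.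
have ffin := integrable_fin_num measurableT fi.
move: E1; rewrite eN integralN; last by apply: integrable_add_def.
rewrite /comp in ffin *; rewrite -(fineK ffin) -EFinN => -[] h.
by congr EFin; move: h; set y := fine _ => h; lra.
Qed.

(** The sign of [x], where [0] has sign [1]: the square is always [1]. *)
Definition sgn1 (x : R) : R := if 0 <= x then 1 else -1.

Lemma sgn1_sqr x : sgn1 x ^+ 2 = 1.
Proof. by rewrite /sgn1; case: ifP => _; rewrite ?sqrrN expr1n. Qed.

Lemma sgn1M x : sgn1 x * x = `|x|.
Proof.
by rewrite /sgn1; case: ifPn => h; [rewrite mul1r ger0_norm|
  rewrite mulN1r ltr0_norm// ltNge].
Qed.

Lemma norm_sgn1 x : `|sgn1 x| = 1.
Proof. by rewrite /sgn1; case: ifP; rewrite ?normrN normr1. Qed.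

Lemma measurable_sgn1 : measurable_fun setT sgn1.
Proof.
apply: measurable_fun_ifT => //.
by apply: measurable_fun_ler.
Qed.

Lemma integral_norm_normal_gt0 : (0 < \int[gam]_x (`|x|)%:E)%E.
Proof.
have mn : measurable_fun [set: R] (fun x : R => (`|x|)%:E).
  by apply/measurable_EFinP; exact: normr_measurable.
rewrite lt_neqAle integral_ge0 ?andbT; last first.
  by move=> x _; rewrite lee_fin.
apply/negP => /eqP/esym h0.
have : (\int[gam]_x `|(x%:E)| = 0)%E by [].
move=> /(ae_eq_integral_abs gam measurableT
  (proj2 (measurable_EFinP _ _) (@measurable_id _ _ setT))).
move=> [N [mN N0 sub]].
have mu0 : gam [set 0] = 0.
  have /null_content_dominatesP := @normal_prob_dominates R 0 1.
  by apply => //; exact: lebesgue_measure_set1.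
have : (gam setT <= gam (N `|` [set 0 : R]%R))%E.
  apply: le_measure; rewrite ?inE//; first exact: measurableU.
  move=> x _; have [->|x0] := eqVneq x 0; [by right|left].
  by apply: sub => /= /(_ I) []; exact/eqP.
have le2 : (gam (N `|` [set 0 : R]%R) <= gam N + gam [set 0 : R]%R)%E.
  exact: measureU2.
rewrite N0 mu0 adde0 in le2 => /le_trans/(_ le2).
by rewrite probability_setT leNgt lte01.
Qed.

End normal_moments.

(** * Independent standard Gaussians on a product space *)

Section product_space.
Context {R : realType}.
Local Notation gam := (@normal_prob R 0 1).

Lemma integral_prod_mul d1 d2 (T1 : measurableType d1) (T2 : measurableType d2)
    (P : probability T1 R) (Q : probability T2 R) (u : T1 -> R) (v : T2 -> R) :
  P.-integrable setT (EFin \o u) -> Q.-integrable setT (EFin \o v) ->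
  (P \x Q)%E.-integrable setT (fun w => (u w.1 * v w.2)%:E) /\
  (\int[P \x Q]_w (u w.1 * v w.2)%:E = \int[P]_x (u x)%:E * \int[Q]_y (v y)%:E)%E.
Proof.
move=> iu iv.
have mu : measurable_fun setT u by apply/measurable_EFinP; exact: measurable_int iu.
have mv : measurable_fun setT v by apply/measurable_EFinP; exact: measurable_int iv.
have muv : measurable_fun setT (fun w : T1 * T2 => (u w.1 * v w.2)%:E).
  apply/measurable_EFinP; apply: measurable_funM.
    exact: (measurableT_comp mu measurable_fst).
  exact: (measurableT_comp mv measurable_snd).
have iv_fin := integrable_fin_num measurableT iv.
have iuv : (P \x Q)%E.-integrable setT (fun w => (u w.1 * v w.2)%:E).
  apply/integrable12ltyP => //.
  under eq_integral => x _.
    under eq_integral => y _ do rewrite /= normrM EFinM.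
    rewrite ge0_integralZl//; last by apply/measurable_EFinP; exact: measurableT_comp.
    over.
  rewrite /= ge0_integralZr//; last 2 first.
  - by apply/measurable_EFinP; exact: measurableT_comp.
  - exact: integral_ge0.
  have /integrableP[_ h1] := iu; have /integrableP[_ h2] := iv.
  by apply: lte_mul_pinfty => //; [exact: integral_ge0|
    rewrite ge0_fin_numE//; exact: integral_ge0].
split => //.
rewrite -integral12_prod_meas1// /fubini_F.
transitivity (\int[P]_x ((u x)%:E * \int[Q]_y (v y)%:E))%E.
  by apply: eq_integral => x _; rewrite -(integralZl measurableT iv).
rewrite -(fineK iv_fin).
exact: (integralZr measurableT iu).
Qed.

(** The mean of [f] under the standard normal law; meaningful for integrable [f]. *)
Definition normal_mean (f : R -> R) : R := fine (\int[gam]_x (f x)%:E)%E.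

(** The [g i] are independent and standard normal, expressed by the rule for
    expectations of products of functions of the [g i]. *)
Definition product_rule d (T : measurableType d) (P : probability T R) n
    (g : 'I_n -> T -> R) : Prop :=
  forall f : 'I_n -> R -> R, (forall i, gam.-integrable setT (EFin \o f i)) ->
    P.-integrable setT (fun w => (\prod_i f i (g i w))%:E) /\
    (\int[P]_w (\prod_i f i (g i w))%:E = (\prod_i normal_mean (f i))%:E)%E.

(** The statement is an informative one, so that a space can be picked for each
    [n] without choice. *)
Lemma gaussian_space n :
  {d : measure_display & {T : measurableType d & {P : probability T R &
   {g : 'I_n -> T -> R | (forall i, measurable_fun setT (g i)) /\ product_rule P g}}}}.
Proof.
elim: n => [|n [d [T [P [g [mg pg]]]]]].
  exists _, (measurableTypeR R), gam, (fun _ _ => 0); split => [[]//|f _].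
  have -> : (fun w : R => (\prod_(i < 0) f i 0)%:E) = cst 1%:E.
    by apply/funext => w; rewrite big_ord0.
  split; first exact: finite_measure_integrable_cst.
  by rewrite big_ord0 integral_cst//= -[LHS]/(1 * gam setT)%E probability_setT mule1.
exists _, (T * measurableTypeR R)%type, (P \x gam)%E.
exists (fun i w => if unlift ord0 i is Some j then g j w.1 else w.2); split.
  move=> i; case: unlift => [j|]; last exact: measurable_snd.
  exact: (measurableT_comp (mg j) measurable_fst).
move=> f fi.
have [i1 e1] := pg (fun i => f (lift ord0 i)) (fun i => fi _).
have [i2 e2] := integral_prod_mul i1 (fi ord0).
have E : (fun w : T * measurableTypeR R => (\prod_i f i
   (if unlift ord0 i is Some j then g j w.1 else w.2))%:E) =
  (fun w => ((\prod_(i < n) f (lift ord0 i) (g i w.1)) * f ord0 w.2)%:E).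
  apply/funext => w; rewrite big_ord_recl unlift_none mulrC; congr (_ * _)%:E.
  by apply: eq_bigr => i _; rewrite liftK.
rewrite E; split; first exact: i2.
rewrite e2 /= e1 big_ord_recl mulrC EFinM; congr (_ * _)%E.
by rewrite /normal_mean fineK//; exact: integrable_fin_num (fi ord0).
Qed.

End product_space.

(** * Expectations of polynomials in Gaussians and their signs *)

Section has_mean.
Context {R : realType} d (T : measurableType d) (P : probability T R).

(** [f] is integrable with expectation [c]. *)
Definition has_mean (f : T -> R) (c : R) : Prop :=
  P.-integrable setT (EFin \o f) /\ (\int[P]_w (f w)%:E = c%:E)%E.

Lemma has_mean0 : has_mean (fun=> 0) 0.
Proof.
split; first exact: finite_measure_integrable_cst.
by rewrite integral0.
Qed.

Lemma has_mean_eq f f' c c' : has_mean f c -> f =1 f' -> c = c' ->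
  has_mean f' c'.
Proof. by move=> h /funext <- <-. Qed.

Lemma has_meanD f1 f2 c1 c2 : has_mean f1 c1 -> has_mean f2 c2 ->
  has_mean (fun w => f1 w + f2 w) (c1 + c2).
Proof.
move=> [i1 e1] [i2 e2]; split.
  by rewrite (_ : _ \o _ = (EFin \o f1) \+ (EFin \o f2))//; exact: integrableD.
by rewrite EFinD -e1 -e2 -(integralD measurableT i1 i2).
Qed.

Lemma has_meanZ k f c : has_mean f c -> has_mean (fun w => k * f w) (k * c).
Proof.
move=> [i1 e1]; split.
  rewrite (_ : _ \o _ = (fun w => k%:E * (EFin \o f) w)%E)//.
  exact: integrableZl.
by rewrite EFinM -e1 -(integralZl measurableT i1).
Qed.

Lemma has_mean_sum (I : Type) (r : seq I) (Q : pred I) (f : I -> T -> R) (c : I -> R) :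
  (forall i, Q i -> has_mean (f i) (c i)) ->
  has_mean (fun w => \sum_(i <- r | Q i) f i w) (\sum_(i <- r | Q i) c i).
Proof.
move=> h; elim: r => [|i r IH].
  by under eq_fun do rewrite big_nil; rewrite big_nil; exact: has_mean0.
under eq_fun do rewrite big_cons; rewrite big_cons.
by case: ifP => Qi //; apply: has_meanD => //; exact: h.
Qed.

Lemma fine_expectation_has_mean f c : has_mean f c -> fine 'E_P[f] = c.
Proof. by move=> [_ e]; rewrite unlock e. Qed.

End has_mean.

Section gaussian_family.
Context {R : realType}.
Local Notation gam := (@normal_prob R 0 1).

(** A product of powers in which only the factor of index [j] survives. *)
Lemma prod_exp_eq n (F : 'I_n -> R) j (a : nat) :
  \prod_i F i ^+ ((i == j) * a) = F j ^+ a.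
Proof.
rewrite (bigD1 j)//= eqxx mul1n big1 ?mulr1// => i /negbTE ->.
by rewrite mul0n expr0.
Qed.

Lemma normal_mean1 : normal_mean (fun _ : R => 1) = 1.
Proof.
by rewrite /normal_mean integral_cst//= -[X in fine X]/(1 * gam setT)%E
  probability_setT mule1.
Qed.

Lemma normal_mean_indic (B : set R) : measurable B ->
  (normal_mean \1_B)%:E = gam B.
Proof.
move=> mB; rewrite /normal_mean integral_indic// setIT fineK//.
exact: fin_num_measure.
Qed.

Lemma normal_mean_id : normal_mean (fun x : R => x) = 0.
Proof.
rewrite /normal_mean integral_odd_normal//.
apply: integrable_normal_le => // x.
have := sqr_ge0 (`|x| - 1); rewrite -(real_normK (num_real x)).
by have := normr_ge0 x; set y := `|x|; nra.
Qed.

Lemma integrable_sgn1_exp (a b : nat) : (b <= 2)%N ->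
  gam.-integrable setT (EFin \o (fun x : R => sgn1 x ^+ a * x ^+ b)).
Proof.
move=> b2; apply: integrable_normal_le.
  by apply: measurable_funM; apply: measurable_funX => //; exact: measurable_sgn1.
move=> x; rewrite normrM !normrX norm_sgn1 expr1n mul1r -(real_normK (num_real x)).
have := normr_ge0 x; set y := `|x| => y0.
have := sqr_ge0 (y - 1).
by case: b b2 => [|[|[|]]]// _; rewrite ?expr0 ?expr1; nra.
Qed.

Variables (d : measure_display) (T : measurableType d) (P : probability T R).
Variables (n : nat) (g : 'I_n -> T -> R).
Hypotheses (mg : forall i, measurable_fun setT (g i)) (pg : product_rule P g).

Lemma product_rule_prob (J : {set 'I_n}) (B : 'I_n -> set R) :
  (forall i, i \in J -> measurable (B i)) ->
  P (\bigcap_(i in [set` J]) (g i @^-1` B i)) = (\prod_(i in J) gam (B i))%E.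
Proof.
move=> mB.
pose f i : R -> R := if i \in J then \1_(B i) else cst 1.
have fi i : gam.-integrable setT (EFin \o f i).
  rewrite /f; case: ifPn => iJ; last exact: finite_measure_integrable_cst.
  by apply: integrable_indic; exact: mB.
have [_ e] := pg fi.
have mI : measurable (\bigcap_(i in [set` J]) (g i @^-1` B i)).
  apply: fin_bigcap_measurable => // i iJ.
  by rewrite -[X in measurable X]setTI; apply: mg => //; exact: mB.
transitivity (\int[P]_w (\1_(\bigcap_(i in [set` J]) (g i @^-1` B i)) w)%:E)%E.
  by rewrite integral_indic// setIT.
transitivity (\int[P]_w (\prod_i f i (g i w))%:E)%E.
  apply: eq_integral => w _; congr EFin; rewrite indicE.
  have [wI|wI] := boolP (w \in _).
    rewrite big1// => i _; rewrite /f; case: ifPn => // iJ.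
    by rewrite indicE mem_set//; move: wI; rewrite inE => /(_ i iJ).
  have [i [iJ nB]] : exists i, i \in J /\ ~ B i (g i w).
    apply: contrapT => h; move/negP: wI; apply; rewrite inE => i /= iJ.
    by apply: contrapT => nB; apply: h; exists i.
  by rewrite (bigD1 i)//= /f iJ indicE memNset// mul0r.
rewrite e (big_morph EFin EFinM (erefl _)) [in RHS]big_mkcond/=.
apply: eq_bigr => i _; rewrite /f; case: ifPn => iJ.
  by rewrite normal_mean_indic//; exact: mB.
by rewrite normal_mean1.
Qed.

Lemma product_rule_law i (B : set R) : measurable B ->
  P (g i @^-1` B) = gam B.
Proof.
move=> mB.
have := @product_rule_prob [set i]%SET (fun _ => B) (fun _ _ => mB).
rewrite big_set1 => <-; congr (P _); apply/seteqP; split => w /=.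
  by move=> h j /=; rewrite inE => /eqP ->.
by move=> /(_ i); apply; rewrite /= inE.
Qed.

Lemma product_rule_iid : iid_standard_gaussian P g.
Proof.
split=> [i|J B _ mB].
  by split; [exact: mg|exact: product_rule_law].
rewrite product_rule_prob//; apply: eq_bigr => i iJ.
by rewrite product_rule_law//; exact: mB.
Qed.

Lemma has_mean_monomial (a b : 'I_n -> nat) : (forall i, (b i <= 2)%N) ->
  has_mean P (fun w => \prod_i (sgn1 (g i w) ^+ a i * g i w ^+ b i))
    (\prod_i normal_mean (fun x => sgn1 x ^+ a i * x ^+ b i)).
Proof. by move=> b2; apply: pg => i; exact: integrable_sgn1_exp. Qed.

(** The second moment and the first absolute moment of the standard normal law.
    Their values are not needed. *)
Definition normal_variance : R := normal_mean (fun x => x ^+ 2).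
Definition normal_abs_mean : R := normal_mean (fun x => `|x|).

Lemma normal_abs_mean_gt0 : 0 < normal_abs_mean.
Proof.
have h : gam.-integrable setT (fun x : R => (`|x|)%:E).
  have := @integrable_sgn1_exp 1 1 isT.
  by under eq_fun do rewrite !expr1 sgn1M.
rewrite -lte_fin /normal_abs_mean /normal_mean fineK.
  exact: integral_norm_normal_gt0.
exact: (integrable_fin_num measurableT h).
Qed.

Lemma normal_variance_ge0 : 0 <= normal_variance.
Proof.
rewrite /normal_variance /normal_mean fine_ge0// integral_ge0// => x _.
by rewrite lee_fin sqr_ge0.
Qed.

Lemma has_mean_mul k l :
  has_mean P (fun w => g k w * g l w) ((k == l)%:R * normal_variance).
Proof.
pose b i := ((i == k) * 1 + (i == l) * 1)%N.
have b2 i : (b i <= 2)%N by rewrite /b; do 2 case: eqP.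
apply: has_mean_eq (@has_mean_monomial (fun=> 0%N) b b2) _ _ => [w|].
  under eq_bigr do rewrite expr0 mul1r exprD.
  by rewrite big_split/= !(prod_exp_eq (fun i => g i w)) !expr1.
rewrite /b; have [->|kl] := eqVneq k l; last first.
  rewrite (bigD1 k)//= eqxx (negbTE kl) mul0r.
  rewrite (_ : normal_mean _ = 0) ?mul0r// -normal_mean_id.
  by congr normal_mean; apply/funext => x; rewrite expr0 mul1r.
rewrite mul1r (bigD1 l)//= big1 => [|i il].
  rewrite mulr1; congr normal_mean; apply/funext => x.
  by rewrite expr0 mul1r eqxx.
rewrite -normal_mean1; congr normal_mean; apply/funext => x.
by rewrite (negbTE il) !expr0 mul1r.
Qed.

Lemma has_mean_sgn_mul k : has_mean P (fun w => sgn1 (g k w) * g k w) normal_abs_mean.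
Proof.
pose b i := ((i == k) * 1)%N.
have b2 i : (b i <= 2)%N by rewrite /b; case: eqP.
apply: has_mean_eq (@has_mean_monomial b b b2) _ _ => [w|].
  by rewrite big_split/= (prod_exp_eq (fun i => sgn1 (g i w)))
    (prod_exp_eq (fun i => g i w)) !expr1.
rewrite (bigD1 k)//= big1 => [|i ik].
  rewrite mulr1; congr normal_mean; apply/funext => x.
  by rewrite /b eqxx !expr1 sgn1M.
rewrite -normal_mean1; congr normal_mean; apply/funext => x.
by rewrite /b (negbTE ik) !expr0 mul1r.
Qed.

(** A Gaussian multiplied by signs of other Gaussians has mean zero; an exponent
    [0] cancels the sign next to it. *)
Lemma has_mean_sgn_sgn_mul j k l (a b : nat) : (j != l) || (a == 0%N) ->
  (k != l) || (b == 0%N) ->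
  has_mean P (fun w => sgn1 (g j w) ^+ a * sgn1 (g k w) ^+ b * g l w) 0.
Proof.
move=> ja kb.
pose e i := ((i == j) * a + (i == k) * b)%N.
pose b' i := ((i == l) * 1)%N.
have b2 i : (b' i <= 2)%N by rewrite /b'; case: eqP.
apply: has_mean_eq (@has_mean_monomial e b' b2) _ _ => [w|].
  under eq_bigr do rewrite exprD.
  by rewrite !big_split/= !(prod_exp_eq (fun i => sgn1 (g i w)))
    (prod_exp_eq (fun i => g i w)) expr1.
rewrite (bigD1 l)//=.
rewrite (_ : normal_mean _ = 0) ?mul0r// -normal_mean_id.
congr normal_mean; apply/funext => x; rewrite /e /b' eqxx expr1.
rewrite (_ : (_ * a + _ = 0)%N) ?expr0 ?mul1r//.
by case/orP: ja => [|/eqP->]; case/orP: kb => [|/eqP->];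
  rewrite ?muln0 ?(eq_sym l) => //; do ?move=> /negbTE->.
Qed.

End gaussian_family.

(** * Adjoints, tensor products and the operator norm *)

Section adjoint.
Context {R : realType}.
Local Notation C := R[i].

Lemma adjmxM m n p (A : 'M[C]_(m, n)) (B : 'M[C]_(n, p)) :
  (A *m B)^t* = B^t* *m A^t*.
Proof. by rewrite trmx_mul map_mxM. Qed.

Lemma adjmxK m n (A : 'M[C]_(m, n)) : A^t*^t* = A.
Proof. by apply/matrixP => i j; rewrite !mxE conjCK. Qed.

Lemma adjmxD m n (A B : 'M[C]_(m, n)) : (A + B)^t* = A^t* + B^t*.
Proof. by rewrite raddfD/= map_mxD. Qed.

Lemma adjmx0 m n : (0 : 'M[C]_(m, n))^t* = 0.
Proof. by rewrite trmx0 map_mx0. Qed.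

Lemma adjmx_sum m n (I : Type) (r : seq I) (F : I -> 'M[C]_(m, n)) :
  (\sum_(k <- r) F k)^t* = \sum_(k <- r) (F k)^t*.
Proof.
by elim: r => [|a r IH]; rewrite ?big_nil ?adjmx0// !big_cons adjmxD IH.
Qed.

Lemma adjmx_real_scalar n (k : R) : ((k%:C)%:M : 'M[C]_n)^t* = (k%:C)%:M.
Proof. by rewrite tr_scalar_mx map_scalar_mx; congr _%:M; exact: conjc_real. Qed.

Lemma adjmxB m n (A B : 'M[C]_(m, n)) : (A - B)^t* = A^t* - B^t*.
Proof. by rewrite raddfB/= map_mxB. Qed.

Lemma adjmx_realZ m n (k : R) (A : 'M[C]_(m, n)) : (k%:C *: A)^t* = k%:C *: A^t*.
Proof. by rewrite linearZ/= map_mxZ; congr (_ *: _); exact: conjc_real. Qed.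

Lemma adjmxT m n p q (A : 'M[C]_(m, n)) (B : 'M[C]_(p, q)) :
  (A *t B)^t* = A^t* *t B^t*.
Proof. by rewrite trmx_tens map_mxT. Qed.

Lemma adjmx1 n : (1%:M : 'M[C]_n)^t* = 1%:M.
Proof. by rewrite trmx1 map_mx1. Qed.

Lemma tensmx_scalar m n (c d : C) : (c%:M : 'M[C]_m) *t (d%:M : 'M[C]_n) = (c * d)%:M.
Proof.
apply/matrixP=> i j.
case: (mxtens_indexP i) => i0 i1; case: (mxtens_indexP j) => j0 j1.
rewrite tensmxE !mxE (can_eq (@mxtens_indexK _ _)) xpair_eqE.
by do 2 case: eqP => _; rewrite ?mulr1n ?mulr0n ?mul0r ?mulr0.
Qed.

End adjoint.

Section tensor_algebra.
Context {R : realType}.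
Local Notation C := R[i].

Lemma tensmx_suml m n p q (I : Type) (r : seq I) (F : I -> 'M[C]_(m, n))
    (B : 'M[C]_(p, q)) : (\sum_(k <- r) F k) *t B = \sum_(k <- r) (F k *t B).
Proof.
apply/matrixP => i j; rewrite !mxE !summxE mulr_suml.
by apply: eq_bigr => k _; rewrite mxE.
Qed.

Lemma tensmx_sumr m n p q (I : Type) (r : seq I) (F : I -> 'M[C]_(m, n))
    (B : 'M[C]_(p, q)) : B *t (\sum_(k <- r) F k) = \sum_(k <- r) (B *t F k).
Proof.
apply/matrixP => i j; rewrite !mxE !summxE mulr_sumr.
by apply: eq_bigr => k _; rewrite mxE.
Qed.

Lemma tensmxZl m n p q (c : C) (A : 'M[C]_(m, n)) (B : 'M[C]_(p, q)) :
  (c *: A) *t B = c *: (A *t B).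
Proof. by apply/matrixP => i j; rewrite !mxE mulrA. Qed.

Lemma tensmxZr m n p q (c : C) (A : 'M[C]_(m, n)) (B : 'M[C]_(p, q)) :
  A *t (c *: B) = c *: (A *t B).
Proof. by apply/matrixP => i j; rewrite !mxE mulrCA. Qed.

(** [U] is the permutation matrix that exchanges the two tensor factors; the
    cast identifies the dimensions [N * d] and [d * N]. *)
Lemma tensor_swap d N : exists2 U : 'M[C]_(d * N), U \is unitarymx &
  forall G : 'M[C]_N, U^t* *m castmx (mulnC N d, mulnC N d) (G *t 1%:M) *m U
    = 1%:M *t G.
Proof.
pose f (k : 'I_(d * N)) : 'I_(d * N) := cast_ord (mulnC N d)
  (mxtens_index ((mxtens_unindex k).2, (mxtens_unindex k).1)).
have finj : injective f.
  move=> k l /cast_ord_inj/(can_inj (@mxtens_indexK _ _)) h.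
  apply: (can_inj (@mxtens_unindexK _ _)); move: h.
  by case: (mxtens_unindex k) => a b; case: (mxtens_unindex l) => a' b' [-> ->].
pose s := perm finj.
have adjU : (perm_mx s^-1%g : 'M[C]_(d * N))^t* = perm_mx s.
  by rewrite tr_perm_mx invgK map_perm_mx.
exists (perm_mx s^-1%g).
  by apply/unitarymxP; rewrite adjU -perm_mxM mulVg perm_mx1.
move=> G; rewrite adjU -row_permE -col_permE.
apply/matrixP => i j; rewrite !mxE castmxE !permE /f !mxE !cast_ordK !mxtens_indexK /=.
by rewrite mulrC.
Qed.

(** Quadratic forms at product vectors add up under tensor sums. *)
Lemma tens_quadratic_form d N (X : 'M[C]_d) (G : 'M[C]_N) (x : 'cV[C]_d)
    (v : 'cV[C]_N) (p q : C) :
  x^t* *m x = 1%:M -> v^t* *m v = 1%:M ->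
  x^t* *m X *m x = p%:M -> v^t* *m G *m v = q%:M ->
  exists2 y : 'cV[C]_(d * N), y^t* *m y = 1%:M &
    y^t* *m (X *t 1%:M + 1%:M *t G) *m y = (p + q)%:M.
Proof.
move=> x1 v1 xX vG; exists (x *t v : 'cV[C]_(d * N)).
  rewrite (adjmxT x v) (tensmx_mul (x^t*) (v^t*) x v) x1 v1.
  by rewrite (@tensmx_scalar _ 1 1) mulr1.
rewrite (adjmxT x v) mulmxDr mulmxDl.
rewrite (tensmx_mul (x^t*) (v^t*) X 1%:M) (tensmx_mul (x^t*) (v^t*) 1%:M G) !mulmx1.
rewrite (tensmx_mul (x^t* *m X) (v^t*) x v) (tensmx_mul (x^t*) (v^t* *m G) x v)
  x1 v1 xX vG.
by rewrite !(@tensmx_scalar _ 1 1) mulr1 mul1r -raddfD.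
Qed.

End tensor_algebra.

Section operator_norm.
Import ComplexField.Normc.
Context {R : realType}.
Local Notation C := R[i].
Local Notation normc := (@ComplexField.Normc.normc R).

Lemma normc_sqr (z : C) : normc z ^+ 2 = complex.Re z ^+ 2 + complex.Im z ^+ 2.
Proof. by case: z => a b /=; rewrite sqr_sqrtr// addr_ge0 ?sqr_ge0. Qed.

Lemma sum_normc_ge0 d (x : 'cV[C]_d) : 0 <= \sum_(i < d) normc (x i ord0) ^+ 2.
Proof. by apply: sumr_ge0 => i _; exact: sqr_ge0. Qed.

Lemma l2norm_sqr d (x : 'cV[C]_d) : l2norm x ^+ 2 = \sum_(i < d) normc (x i ord0) ^+ 2.
Proof. by rewrite /l2norm sqr_sqrtr// sum_normc_ge0. Qed.

Lemma l2norm_ge0 d (x : 'cV[C]_d) : 0 <= l2norm x.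
Proof. exact: sqrtr_ge0. Qed.

Lemma adj_mul_l2norm d (x : 'cV[C]_d) : x^t* *m x = ((l2norm x ^+ 2)%:C)%:M.
Proof.
apply/matrixP => i j; rewrite !ord1 !mxE eqxx mulr1n l2norm_sqr rmorph_sum/=.
apply: eq_bigr => k _; rewrite !mxE normc_sqr.
by case: (x k ord0) => a b; rewrite /=; apply/eqP; rewrite eq_complex/=;
  apply/andP; split; apply/eqP; ring.
Qed.

(** The sum of the moduli of the entries bounds [l2norm (A *m x)] on the unit
    ball, so that the supremum defining [opnorm A] is a genuine one. *)
Lemma has_sup_opnorm d (A : 'M[C]_d) :
  has_sup [set l2norm (A *m x) | x in [set x : 'cV[C]_d | l2norm x <= 1]].
Proof.
split.
  exists (l2norm (A *m 0)); exists 0 => //=.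
  by rewrite /l2norm big1 ?sqrtr0// => i _; rewrite mxE normc0 expr0n.
pose K := \sum_i \sum_j normc (A i j).
have n0 z : 0 <= normc z by case: z => a b; exact: sqrtr_ge0.
exists K => _ [x /= x1 <-].
have xi i : normc (x i ord0) <= 1.
  rewrite -(@expr_le1 _ 2)//; have : l2norm x ^+ 2 <= 1 by rewrite expr_le1 ?l2norm_ge0.
  apply: le_trans; rewrite l2norm_sqr (bigD1 i)//= lerDl.
  by apply: sumr_ge0 => k _; exact: sqr_ge0.
have K0 : 0 <= K by apply: sumr_ge0 => i _; apply: sumr_ge0.
have nsum I (r : seq I) (F : I -> C) :
    normc (\sum_(j <- r) F j) <= \sum_(j <- r) normc (F j).
  elim: r => [|a r IH]; first by rewrite !big_nil normc0.
  by rewrite !big_cons (le_trans (le_normcD _ _))// lerD2l.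
have yi i : normc ((A *m x) i ord0) <= \sum_j normc (A i j).
  rewrite mxE (le_trans (nsum _ _ _))// ler_sum// => j _.
  by rewrite normcM ler_piMr.
rewrite -ler_sqr ?nnegrE ?l2norm_ge0// l2norm_sqr.
apply: (@le_trans _ _ (\sum_i (\sum_j normc (A i j)) * K)).
  apply: ler_sum => i _; rewrite expr2; apply: ler_pM => //.
  rewrite (le_trans (yi i))// /K [leRHS](bigD1 i)//= lerDl.
  by apply: sumr_ge0 => k _; apply: sumr_ge0.
by rewrite -mulr_suml expr2.
Qed.

Lemma opnorm_ge0 d (A : 'M[C]_d) : 0 <= opnorm A.
Proof.
have [_ hu] := has_sup_opnorm A.
have l0 : l2norm (0 : 'cV[C]_d) <= 1.
  by rewrite /l2norm big1 ?sqrtr0// => i _; rewrite mxE normc0 expr0n.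
apply: (@le_trans _ _ (l2norm (A *m 0))); first exact: l2norm_ge0.
by apply: ub_le_sup => //; exists 0.
Qed.

Lemma opnorm_ge_quadratic_form d (A : 'M[C]_d) (x : 'cV[C]_d) (q : R) :
  x^t* *m x = 1%:M -> x^t* *m A *m x = (q%:C)%:M -> q <= opnorm A.
Proof.
move=> x1 xA.
have lx : l2norm x = 1.
  have : (l2norm x ^+ 2)%:C = 1 :> C.
    move: x1; rewrite adj_mul_l2norm => /matrixP/(_ ord0 ord0).
    by rewrite !mxE eqxx !mulr1n.
  case=> /eqP; rewrite sqrf_eq1 => /orP[/eqP //|/eqP h].
  by have := l2norm_ge0 x; rewrite h ler0N1.
have [_ hu] := has_sup_opnorm A.
apply: (@le_trans _ _ (l2norm (A *m x))); last first.
  by apply: ub_le_sup => //; exists x => //=; rewrite lx.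
set y := A *m x.
have xy : x^t* *m y = (q%:C)%:M by rewrite /y mulmxA.
have yx : y^t* *m x = (q%:C)%:M.
  rewrite -[x in LHS]adjmxK -adjmxM xy.
  exact: adjmx_real_scalar.
(* Cauchy-Schwarz: y - q x is the component of y orthogonal to x *)
have := sqr_ge0 (l2norm (y - q%:C *: x)).
have -> : l2norm (y - q%:C *: x) ^+ 2 = l2norm y ^+ 2 - q ^+ 2.
  apply: (@complexI R).
  have := adj_mul_l2norm (y - q%:C *: x).
  rewrite adjmxB adjmx_realZ mulmxBl !mulmxBr.
  rewrite -!scalemxAl -!scalemxAr xy yx x1 adj_mul_l2norm.
  move=> /matrixP/(_ ord0 ord0); rewrite !mxE eqxx !mulr1n => <-.
  by rewrite !rmorphB/= !rmorphXn/=; ring.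
rewrite subr_ge0 => h; have [q0|q0] := leP q 0.
  exact: le_trans q0 (l2norm_ge0 _).
by rewrite -ler_sqr ?nnegrE ?l2norm_ge0 ?(ltW q0).
Qed.

Lemma opnorm_scalar_mx d (k : R) : 0 <= k -> opnorm ((k%:C)%:M : 'M[C]_d) <= k.
Proof.
move=> k0; apply: ge_sup; first by have [] := has_sup_opnorm ((k%:C)%:M : 'M[C]_d).
move=> _ [x /= x1 <-].
rewrite mul_scalar_mx.
have -> : l2norm (k%:C *: x) = k * l2norm x.
  rewrite /l2norm -[k in RHS](ger0_norm k0) -sqrtr_sqr -sqrtrM ?sqr_ge0// mulr_sumr.
  congr Num.sqrt; apply: eq_bigr => i _; rewrite mxE normcM exprMn normc_sqr/=.
  by rewrite expr0n addr0 sqr_sqrtr ?sqr_ge0.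
by rewrite ler_piMr.
Qed.

End operator_norm.

(** * Gaussian series and their second moments *)

Section gaussian_series_algebra.
Context {R : realType} {disp : measure_display} {T : measurableType disp}.
Variables (n : nat) (g : 'I_n -> T -> R).
Local Notation C := R[i].
Local Notation series := (gaussian_series g).

Lemma gaussian_seriesD d (A B : 'I_n -> 'M[C]_d) :
  series (fun k => A k + B k) = (fun w => series A w + series B w).
Proof.
apply/funext => w; rewrite /gaussian_series -big_split/=.
by apply: eq_bigr => k _; rewrite scalerDr.
Qed.

Lemma gaussian_series_tensl d N (A : 'I_n -> 'M[C]_d) (B : 'M[C]_N) :
  series (fun k => A k *t B) = (fun w => series A w *t B).
Proof.
apply/funext => w; rewrite /gaussian_series tensmx_suml.
by apply: eq_bigr => k _; rewrite tensmxZl.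
Qed.

Lemma gaussian_series_tensr d N (A : 'M[C]_d) (B : 'I_n -> 'M[C]_N) :
  series (fun k => A *t B k) = (fun w => A *t series B w).
Proof.
apply/funext => w; rewrite /gaussian_series tensmx_sumr.
by apply: eq_bigr => k _; rewrite tensmxZr.
Qed.

Lemma gaussian_series_castmx d d' (e : d = d') (A : 'I_n -> 'M[C]_d) :
  series (fun k => castmx (e, e) (A k)) = (fun w => castmx (e, e) (series A w)).
Proof.
subst d'; apply/funext => w; rewrite castmx_id.
by apply: eq_bigr => k _; rewrite castmx_id.
Qed.

End gaussian_series_algebra.

Section second_moments.
Context {R : realType} {disp : measure_display} {T : measurableType disp}.
Variables (P : probability T R) (n : nat) (g : 'I_n -> T -> R) (v : R).
Hypothesis cov : forall k l,
  has_mean P (fun w => g k w * g l w) ((k == l)%:R * v).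
Local Notation C := R[i].

Lemma Re_sum (I : Type) (r : seq I) (F : I -> C) :
  complex.Re (\sum_(k <- r) F k) = \sum_(k <- r) complex.Re (F k).
Proof. by apply: (big_morph _ _ (erefl _)) => -[a b] [c e]. Qed.

Lemma Im_sum (I : Type) (r : seq I) (F : I -> C) :
  complex.Im (\sum_(k <- r) F k) = \sum_(k <- r) complex.Im (F k).
Proof. by apply: (big_morph _ _ (erefl _)) => -[a b] [c e]. Qed.

Lemma ReZ (r : R) (z : C) : complex.Re (r%:C * z) = complex.Re z * r.
Proof. by case: z => a b /=; ring. Qed.

Lemma ImZ (r : R) (z : C) : complex.Im (r%:C * z) = complex.Im z * r.
Proof. by case: z => a b /=; ring. Qed.

Lemma has_mean_bilinear (c : 'I_n -> 'I_n -> R) :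
  has_mean P (fun w => \sum_k \sum_l c k l * (g k w * g l w)) (v * \sum_k c k k).
Proof.
have h : has_mean P (fun w => \sum_k \sum_l c k l * (g k w * g l w))
    (\sum_k \sum_l c k l * ((k == l)%:R * v)).
  by apply: has_mean_sum => k _; apply: has_mean_sum => l _; exact: has_meanZ.
apply: has_mean_eq h _ _ => //.
rewrite mulr_sumr; apply: eq_bigr => k _; rewrite (bigD1 k)//= eqxx big1.
  by rewrite addr0 mul1r mulrC.
by move=> l; rewrite eq_sym => /negbTE ->; rewrite mul0r mulr0.
Qed.

Lemma mx_expectation_bilinear d (M : 'I_n -> 'I_n -> 'M[C]_d) :
  mx_expectation P (fun w => \sum_k \sum_l (g k w * g l w)%:C *: M k l) =
  v%:C *: \sum_k M k k.
Proof.
apply/matrixP => i j; rewrite !mxE summxE.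
have -> : (fun w => complex.Re ((\sum_k \sum_l (g k w * g l w)%:C *: M k l) i j)) =
    (fun w => \sum_k \sum_l complex.Re (M k l i j) * (g k w * g l w)).
  apply/funext => w; rewrite summxE Re_sum; apply: eq_bigr => k _.
  by rewrite summxE Re_sum; apply: eq_bigr => l _; rewrite mxE ReZ.
have -> : (fun w => complex.Im ((\sum_k \sum_l (g k w * g l w)%:C *: M k l) i j)) =
    (fun w => \sum_k \sum_l complex.Im (M k l i j) * (g k w * g l w)).
  apply/funext => w; rewrite summxE Im_sum; apply: eq_bigr => k _.
  by rewrite summxE Im_sum; apply: eq_bigr => l _; rewrite mxE ImZ.
rewrite !(fine_expectation_has_mean (has_mean_bilinear _)).
by apply/eqP; rewrite eq_complex ReZ ImZ Re_sum Im_sum/= !(mulrC v) !eqxx.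
Qed.

Lemma mx_sigma_gaussian_series d (A : 'I_n -> 'M[C]_d) (c : R) : 0 <= v -> 0 <= c ->
  (forall k, (A k)^t* = A k) -> \sum_k A k *m A k = (c%:C)%:M ->
  mx_sigma P (gaussian_series g A) <= Num.sqrt (v * c).
Proof.
move=> v0 c0 Ah A2.
have Xh w : (gaussian_series g A w)^t* = gaussian_series g A w.
  rewrite /gaussian_series adjmx_sum; apply: eq_bigr => k _.
  by rewrite adjmx_realZ Ah.
have -> : mx_sigma P (gaussian_series g A) = Num.sqrt (opnorm (mx_expectation P
    (fun w => gaussian_series g A w *m gaussian_series g A w))).
  rewrite /mx_sigma; congr Num.sqrt.
  have -> : (fun w => (gaussian_series g A w)^t* *m gaussian_series g A w) =
    (fun w => gaussian_series g A w *m gaussian_series g A w).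
    by apply/funext => w; rewrite Xh.
  have -> : (fun w => gaussian_series g A w *m (gaussian_series g A w)^t*) =
    (fun w => gaussian_series g A w *m gaussian_series g A w).
    by apply/funext => w; rewrite Xh.
  by rewrite maxxx.
apply: ler_wsqrtr.
have -> : (fun w => gaussian_series g A w *m gaussian_series g A w) =
    (fun w => \sum_k \sum_l (g k w * g l w)%:C *: (A k *m A l)).
  apply/funext => w; rewrite /gaussian_series mulmx_suml; apply: eq_bigr => k _.
  rewrite mulmx_sumr; apply: eq_bigr => l _.
  by rewrite -scalemxAl -scalemxAr scalerA rmorphM.
rewrite mx_expectation_bilinear A2 scale_scalar_mx -rmorphM/=.
by apply: opnorm_scalar_mx; exact: mulr_ge0.
Qed.

End second_moments.

(** * Sums of matrices acting on distinct tensor factors *)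

Section tower.
Context {R : realType}.
Local Notation C := R[i].
Variables (s : mx_functional R) (D : R).
Hypothesis D0 : 0 <= D.
Hypothesis s1 : forall (d : nat) (disp : measure_display) (T : measurableType disp)
    (P : probability T R) (X1 X2 : T -> 'M[C]_d),
  (0 < d)%N -> centered_jointly_gaussian_mx P X1 X2 ->
  s P (fun w => X1 w + X2 w) <= D * (s P X1 + s P X2).
Hypothesis s2 : forall (d : nat) (disp : measure_display) (T : measurableType disp)
    (P : probability T R) (X : T -> 'M[C]_d) (U : 'M[C]_d),
  (0 < d)%N -> centered_gaussian_mx P X -> U \is unitarymx ->
  s P (fun w => U^t* *m X w *m U) <= D * s P X.
Hypothesis s3 : forall (d : nat) (disp : measure_display) (T : measurableType disp)
    (P : probability T R) (X : T -> 'M[C]_d) (N : nat),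
  (0 < d)%N -> (0 < N)%N -> centered_gaussian_mx P X ->
  s P (fun w => X w *t (1%:M : 'M[C]_N)) <= D * s P X.

(** The factor by which the parameter grows after [k] more tensor factors. *)
Fixpoint tower_cst (k : nat) : R :=
  if k is k'.+1 then D ^+ 2 * tower_cst k' + D ^+ 3 else 1.

Context (disp : measure_display) (T : measurableType disp) (P : probability T R).
Variables (n : nat) (g : 'I_n -> T -> R).
Hypothesis iid : iid_standard_gaussian P g.
Local Notation series := (gaussian_series g).

Let centered d (A : 'I_n -> 'M[C]_d) : centered_gaussian_mx P (series A).
Proof. by exists n, g, A. Qed.

Lemma parameter_castmx d d' (e : d = d') (X : T -> 'M[C]_d) :
  s P (fun w => castmx (e, e) (X w)) = s P X.
Proof. by subst d'; congr (s P _); apply/funext => w; rewrite castmx_id. Qed.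

Lemma parameter_tensr d N (B : 'I_n -> 'M[C]_N) : (0 < d)%N -> (0 < N)%N ->
  s P (series (fun l => (1%:M : 'M[C]_d) *t B l)) <= D ^+ 2 * s P (series B).
Proof.
move=> d0 N0; have [U uU eU] := @tensor_swap R d N.
rewrite gaussian_series_tensr.
have -> : (fun w => 1%:M *t series B w) = (fun w => U^t* *m
    castmx (mulnC N d, mulnC N d) (series B w *t 1%:M) *m U).
  by apply/funext => w; rewrite eU.
rewrite expr2 -mulrA (le_trans (@s2 _ _ _ _ _ _ _ _ uU)) ?muln_gt0 ?d0//.
  exists n, g, (fun l => castmx (mulnC N d, mulnC N d) (B l *t 1%:M)); split=> //.
  by rewrite gaussian_series_castmx gaussian_series_tensl.
by rewrite ler_wpM2l// parameter_castmx; exact: s3.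
Qed.

Variables (N m : nat) (B : nat -> 'I_n -> 'M[C]_N) (delta : R).
Hypothesis N0 : (0 < N)%N.
Hypothesis Bherm : forall i l, (B i l)^t* = B i l.
Hypothesis Bsq : forall i, (i < m)%N -> \sum_l B i l *m B i l = 1%:M.
Hypothesis Bdisj : forall i j l, (i < j < m)%N -> B i l = 0 \/ B j l = 0.
Hypothesis Bdelta : forall i, (i < m)%N -> s P (series (B i)) <= delta.

(** [series A] is the sum of the first [k + 1] of the matrices [series (B i)],
    the [i]-th one acting on the [i]-th tensor factor.  Disjointness of the
    coefficient families (no Gaussian drives two of the matrices) makes the
    cross terms of the square vanish; the last clause is the additivity of
    quadratic forms at product vectors. *)
Lemma tensor_tower k : (k < m)%N -> exists d (A : 'I_n -> 'M[C]_d),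
  [/\ d = (N ^ k.+1)%N,
      (forall l, (A l)^t* = A l) /\
      (forall l j, (k < j < m)%N -> A l = 0 \/ B j l = 0),
      \sum_l A l *m A l = ((k.+1%:R : R)%:C)%:M,
      s P (series A) <= tower_cst k * delta
    & forall w (v : nat -> 'cV[C]_N) (q : nat -> R),
        (forall i, (v i)^t* *m v i = 1%:M) ->
        (forall i, (v i)^t* *m series (B i) w *m v i = ((q i)%:C)%:M) ->
        exists2 x : 'cV[C]_d, x^t* *m x = 1%:M &
          x^t* *m series A w *m x = ((\sum_(i < k.+1) q i)%:C)%:M].
Proof.
elim: k => [|k IH] km.
  exists N, (B 0%N); split.
  - by rewrite expn1.
  - by split=> // l j jm; exact: Bdisj.
  - exact: Bsq.
  - by rewrite mul1r; exact: Bdelta.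
  - by move=> w v q v1 vq; exists (v 0%N) => //; rewrite big_ord1.
have [d [A [dE [Ah Ad] A2 As Aq]]] := IH (ltnW km).
have d0 : (0 < d)%N by rewrite dE expn_gt0 N0.
exists (d * N)%N, (fun l => A l *t 1%:M + 1%:M *t B k.+1 l); split.
- by rewrite dE [RHS]expnSr.
- split=> l.
    by rewrite adjmxD !adjmxT !adjmx1 Ah Bherm.
  move=> j /andP[kj jm].
  have [Aj|Bj] : A l = 0 \/ B j l = 0 by apply: Ad; rewrite jm (ltnW kj).
    have [Bk|Bj] : B k.+1 l = 0 \/ B j l = 0 by apply: Bdisj; rewrite kj jm.
      by left; rewrite Aj Bk tens0mx tensmx0 addr0.
    by right.
  by right.
- transitivity (\sum_l ((A l *m A l) *t (1%:M : 'M[C]_N)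
      + (1%:M : 'M[C]_d) *t (B k.+1 l *m B k.+1 l))).
    apply: eq_bigr => l _.
    rewrite mulmxDr !mulmxDl !tensmx_mul !mulmx1 !mul1mx.
    suff -> : A l *t B k.+1 l = 0 by rewrite addr0 add0r.
    have [->|->] : A l = 0 \/ B k.+1 l = 0 by apply: Ad; rewrite ltnSn.
      by rewrite tens0mx.
    by rewrite tensmx0.
  rewrite big_split/= -tensmx_suml -tensmx_sumr A2 Bsq// !tensmx_scalar !mulr1 -raddfD/=.
  by congr _%:M; rewrite -[k.+2]addn1 natrD rmorphD rmorph1.
- rewrite gaussian_seriesD (le_trans (s1 _ _))//.
  + by rewrite muln_gt0 d0.
  + by exists n, g, (fun l => A l *t 1%:M), (fun l => 1%:M *t B k.+1 l).
  have h3 : s P (series (fun l => A l *t (1%:M : 'M[C]_N))) <= D * s P (series A).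
    by rewrite gaussian_series_tensl; exact: s3.
  have h2 := parameter_tensr (B k.+1) d0 N0.
  rewrite /= mulrDl.
  have -> : D ^+ 2 * tower_cst k * delta + D ^+ 3 * delta =
    D * (D * (tower_cst k * delta) + D ^+ 2 * delta) by ring.
  rewrite ler_wpM2l// lerD//.
    by rewrite (le_trans h3)// ler_wpM2l.
  by rewrite (le_trans h2)// ler_wpM2l ?exprn_ge0//; exact: Bdelta.
- move=> w v q v1 vq; have [x x1 xq] := Aq w v q v1 vq.
  rewrite gaussian_seriesD gaussian_series_tensl gaussian_series_tensr.
  rewrite big_ord_recr/= rmorphD/=.
  exact: (tens_quadratic_form x1 (v1 _) xq (vq _)).
Qed.

End tower.

(** * Independent Wigner matrices and their test vectors *)

Section wigner_blocks.
Context {R : realType}.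
Local Notation C := R[i].
Variables (m N : nat).

(** A Gaussian for each matrix [i <= m] and each pair of row and column; only the
    pairs that are ordered increasingly are used. *)
Definition block_index := ('I_m.+1 * ('I_N * 'I_N))%type.
Definition block_size := #|{: block_index}|.

Definition unordered (a c : 'I_N) : 'I_N * 'I_N :=
  if (a <= c)%N then (a, c) else (c, a).

(** The index of the Gaussian that drives the entries [(a, c)] and [(c, a)] of
    the [i]-th matrix. *)
Definition entry_index (i : nat) (a c : 'I_N) : 'I_block_size :=
  enum_rank ((inord i, unordered a c) : block_index).

Lemma unorderedC a c : unordered a c = unordered c a.
Proof.
rewrite /unordered; case: (ltngtP a c) => // h.
by rewrite (_ : a = c)//; exact: val_inj.
Qed.

Lemma entry_indexC i a c : entry_index i a c = entry_index i c a.
Proof. by rewrite /entry_index unorderedC. Qed.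

Lemma unordered_injl a b c : unordered a c = unordered b c -> a = b.
Proof.
rewrite /unordered; case: leqP => ac; case: leqP => bc [] //.
- by move=> -> ->.
- by move=> -> ->.
Qed.

Lemma entry_index_injl i a b c : entry_index i a c = entry_index i b c -> a = b.
Proof. by move=> /enum_rank_inj [] /unordered_injl. Qed.

Lemma entry_index_injr i a b c : entry_index i c a = entry_index i c b -> a = b.
Proof. by rewrite !(entry_indexC i c); exact: entry_index_injl. Qed.

(** The standard deviation of the entries. *)
Definition wigner_scale : R := Num.sqrt (N%:R^-1).

Definition wigner_coef (i : nat) (l : 'I_block_size) : 'M[C]_N :=
  \matrix_(a, c) ((l == entry_index i a c)%:R * wigner_scale)%:C.

Lemma wigner_scale_sqr : wigner_scale ^+ 2 = N%:R^-1.
Proof. by rewrite sqr_sqrtr// invr_ge0. Qed.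

Lemma wigner_coef_herm i l : (wigner_coef i l)^t* = wigner_coef i l.
Proof.
apply/matrixP => a c; rewrite !mxE entry_indexC.
exact: conjc_real.
Qed.

Lemma wigner_coef_sqr i : \sum_l wigner_coef i l *m wigner_coef i l = 1%:M.
Proof.
apply/matrixP => a b; rewrite summxE.
under eq_bigr => l _.
  rewrite mxE.
  under eq_bigr => c _ do rewrite !mxE -rmorphM mulrACA -expr2 wigner_scale_sqr
    -natrM mulnb.
  over.
rewrite exchange_big/=.
have N0 : (N%:R : R) != 0 by rewrite pnatr_eq0; case: N a => // -[].
transitivity (\sum_(c < N) (((a == b)%:R * N%:R^-1 : R)%:C)); last first.
  by rewrite sumr_const card_ord mxE -rmorphMn/= -mulr_natr mulfVK// rmorph_nat.
apply: eq_bigr => c _; rewrite (bigD1 (entry_index i a c))//= eqxx big1 => [|l].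
  rewrite addr0 andTb (_ : (entry_index i a c == entry_index i c b) = (a == b))//.
  rewrite (entry_indexC i c b).
  by apply/eqP/eqP => [/entry_index_injl//|->].
by move=> /negbTE ->; rewrite mul0r.
Qed.

Lemma wigner_coef_disjoint i j l : (i < j <= m)%N ->
  wigner_coef i l = 0 \/ wigner_coef j l = 0.
Proof.
move=> /andP[ij jm].
have coef0 k : (enum_val l).1 != inord k -> wigner_coef k l = 0.
  move=> h; apply/matrixP => a c; rewrite !mxE.
  have [le|] := eqVneq; last by rewrite mul0r.
  by move: h; rewrite le enum_rankK eqxx.
have [li|] := eqVneq ((enum_val l).1) (inord i); last by left; exact: coef0.
right; apply: coef0; rewrite li; apply/eqP => /(congr1 val).
rewrite /= !inordK ?ltnS//; last exact: leq_trans (ltnW ij) jm.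
by move=> e; rewrite e ltnn in ij.
Qed.

Context (disp : measure_display) (T : measurableType disp) (P : probability T R).
Variable (g : 'I_block_size -> T -> R).

(** The [i]-th Wigner matrix. *)
Definition wigner_block (i : nat) : T -> 'M[C]_N := gaussian_series g (wigner_coef i).

Lemma wigner_blockE i w a c :
  wigner_block i w a c = (wigner_scale * g (entry_index i a c) w)%:C.
Proof.
rewrite /wigner_block /gaussian_series summxE (bigD1 (entry_index i a c))//=.
rewrite big1 => [|l].
  by rewrite addr0 !mxE eqxx mul1r -rmorphM mulrC.
by rewrite !mxE => /negbTE ->; rewrite mul0r mulr0.
Qed.

Lemma standard_wigner_block i : (0 < N)%N -> iid_standard_gaussian P g ->
  standard_wigner P (wigner_block i).
Proof.
move=> N0 [gN gI].
have s0 : 0 < wigner_scale by rewrite sqrtr_gt0 invr_gt0 ltr0n.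
pose sp : {posnum R} := PosNum s0.
have mf : measurable_fun [set: R] (fun x : R => wigner_scale * x).
  by apply: measurable_funM.
have mpre (B : set R) : measurable B -> measurable ((fun x => wigner_scale * x) @^-1` B).
  by move=> mB; rewrite -[X in measurable X]setTI; exact: mf.
have eRe a c : (fun w => complex.Re (wigner_block i w a c)) =
    (fun w => wigner_scale * g (entry_index i a c) w).
  by apply/funext => w; rewrite wigner_blockE.
split.
- move=> w; apply/matrixP => a c; rewrite 2!mxE !wigner_blockE entry_indexC.
  exact: conjc_real.
- by move=> w a c; rewrite wigner_blockE.
- move=> a c _; rewrite eRe.
  have [mg lg] := gN (entry_index i a c).
  split; first exact: (measurableT_comp mf mg).
  move=> B mB; rewrite -[RHS](normal_prob_dilation sp mB) -lg//.
  exact: mpre.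
- move=> J B Jord mB.
  have val_entry p : p \in J -> (enum_val (entry_index i p.1 p.2)).2 = p.
    move=> /(fintype.subsetP Jord); rewrite inE enum_rankK /unordered /= => ->.
    by case: p.
  pose J' : {set 'I_block_size} := [set entry_index i p.1 p.2 | p in J]%SET.
  pose B' (l : 'I_block_size) : set R :=
    (fun x => wigner_scale * x) @^-1` B (enum_val l).2.
  have inj : {in J &, injective (fun p => entry_index i p.1 p.2)}.
    by move=> p q pJ qJ e; rewrite -(val_entry p pJ) e val_entry.
  have := gI J' B' (finset.subsetT _) _.
  rewrite big_imset//=.
  have -> : \bigcap_(l in [set` J']) (g l @^-1` B' l) =
     \bigcap_(p in [set` J]) ((fun w => complex.Re (wigner_block i w p.1 p.2)) @^-1` B p).
    apply/seteqP; split => w /= h.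
      move=> p pJ /=; have /h : entry_index i p.1 p.2 \in J' by apply/imsetP; exists p.
      by rewrite /B' /= val_entry// wigner_blockE.
    move=> l /imsetP[p pJ ->] /=; have /= := h p pJ.
    by rewrite /B' /= val_entry// wigner_blockE.
  move=> ->; last first.
    by move=> l /imsetP[p pJ ->]; apply: mpre; rewrite val_entry//; exact: mB.
  apply: eq_bigr => p pJ; congr (P _); apply/seteqP; split => w /=;
    by rewrite /B' /= val_entry// wigner_blockE.
Qed.

Hypothesis pg : product_rule P g.
Variable a0 : 'I_N.

(** The signs of the entries of row [a0], with [1] at [a0] itself. *)
Definition row_sign i w (a : 'I_N) : R := sgn1 (g (entry_index i a0 a) w) ^+ (a != a0).

(** Weights of total squared mass [1], half of it at [a0]. *)
Definition test_weight (a : 'I_N) : R :=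
  if a == a0 then Num.sqrt (2^-1) else Num.sqrt ((2 * (N%:R - 1))^-1).

Definition test_vector i w : 'cV[C]_N :=
  \col_a ((test_weight a * row_sign i w a)%:C).

(** The quadratic form of the [i]-th matrix at its test vector. *)
Definition test_value i w : R := \sum_a \sum_b
  (test_weight a * test_weight b * wigner_scale) *
  (row_sign i w a * row_sign i w b * g (entry_index i a b) w).

Hypothesis N1 : (1 < N)%N.

Let Nm1 : 0 < (N%:R - 1 : R).
Proof. by rewrite subr_gt0 ltr1n. Qed.

Lemma row_sign_sqr i w a : row_sign i w a ^+ 2 = 1.
Proof. by rewrite /row_sign exprAC sgn1_sqr expr1n. Qed.

Lemma sum_neq_const (c : R) : \sum_(a < N | a != a0) c = c * (N%:R - 1).
Proof.
rewrite sumr_const -[X in c *+ X]/(#|predC1 a0|).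
have := cardC1 a0; rewrite card_ord => ->.
by rewrite -[LHS]mulr_natr -(natrB R (ltnW N1)) subn1.
Qed.

Lemma test_vector_unit i w : (test_vector i w)^t* *m test_vector i w = 1%:M.
Proof.
apply/matrixP => x y; rewrite !ord1 !mxE eqxx.
transitivity (\sum_a (test_weight a ^+ 2)%:C : C).
  apply: eq_bigr => a _; rewrite !mxE.
  rewrite (_ : Num.conj _ = (test_weight a * row_sign i w a)%:C); last exact: conjc_real.
  by rewrite -rmorphM/= -expr2 exprMn row_sign_sqr mulr1.
rewrite -rmorph_sum/= (bigD1 a0)//= /test_weight eqxx.
under eq_bigr => a /negbTE aa do rewrite aa.
rewrite sum_neq_const !sqr_sqrtr ?invr_ge0 ?mulr_ge0 ?(ltW Nm1)//.
rewrite (_ : _ + _ = 1); first by rewrite rmorph1.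
by field; rewrite gt_eqF.
Qed.

Lemma test_valueE i w : (test_vector i w)^t* *m wigner_block i w *m test_vector i w
  = ((test_value i w)%:C)%:M.
Proof.
apply/matrixP => x y; rewrite !ord1 [RHS]mxE eqxx mulr1n [LHS]mxE /test_value.
under eq_bigr => b _ do rewrite mxE mulr_suml.
rewrite exchange_big/= rmorph_sum/=; apply: eq_bigr => a _.
rewrite rmorph_sum/=; apply: eq_bigr => b _.
rewrite !mxE wigner_blockE.
rewrite (_ : Num.conj _ = (test_weight a * row_sign i w a)%:C); last exact: conjc_real.
by rewrite -!rmorphM/=; congr (_%:C); ring.
Qed.

(** The signed entry has a nonzero mean only in row and column [a0], off the
    diagonal. *)
Lemma has_mean_signed_entry i a b :
  has_mean P (fun w => row_sign i w a * row_sign i w b * g (entry_index i a b) w)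
    (((a == a0) (+) (b == a0))%:R * normal_abs_mean).
Proof.
rewrite /row_sign; have [->|aa] := eqVneq a a0; have [->|bb] := eqVneq b a0;
  rewrite /= ?mul0r.
- by apply: (has_mean_sgn_sgn_mul pg); rewrite eqxx orbT.
- apply: has_mean_eq (has_mean_sgn_mul pg (entry_index i a0 b)) _ _ => [w|].
    by rewrite expr0 mul1r expr1.
  by rewrite mul1r.
- apply: has_mean_eq (has_mean_sgn_mul pg (entry_index i a0 a)) _ _ => [w|].
    by rewrite expr0 mulr1 expr1 (entry_indexC i a a0).
  by rewrite mul1r.
- apply: (has_mean_sgn_sgn_mul pg).
    apply/orP; left; apply/eqP; rewrite (entry_indexC i a0) => /entry_index_injr e.
    by rewrite -e eqxx in bb.
  apply/orP; left; apply/eqP => /entry_index_injl e.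
  by rewrite -e eqxx in aa.
Qed.

(** The constant [y] is [sqrt ((N - 1) / N)]. *)
Lemma test_value_mean : exists2 y : R, 2^-1 <= y & forall i,
  has_mean P (test_value i) (y * normal_abs_mean).
Proof.
pose al : R := Num.sqrt (2^-1); pose be : R := Num.sqrt ((2 * (N%:R - 1))^-1).
pose y : R := 2 * al * be * (N%:R - 1) * wigner_scale.
have y0 : 0 <= y by rewrite !mulr_ge0 ?sqrtr_ge0// ltW.
have al2 : al ^+ 2 = 2^-1 by rewrite sqr_sqrtr// invr_ge0.
have be2 : be ^+ 2 = (2 * (N%:R - 1))^-1.
  by rewrite sqr_sqrtr// invr_ge0 mulr_ge0// ltW.
exists y.
  rewrite -ler_sqr ?nnegrE ?invr_ge0//.
  rewrite /y !exprMn al2 be2 wigner_scale_sqr.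
  have NR : 2 <= (N%:R : R) by rewrite ler_nat.
  have -> : 2 ^+ 2 * 2^-1 * (2 * (N%:R - 1))^-1 * (N%:R - 1) ^+ 2 * N%:R^-1 =
    (N%:R - 1) / N%:R :> R.
    by field; rewrite !gt_eqF//; lra.
  by rewrite ler_pdivlMr; lra.
move=> i; have h := has_mean_sum (index_enum _) (fun a (_ : true) =>
  has_mean_sum (index_enum _) (fun b (_ : true) =>
    has_meanZ (test_weight a * test_weight b * wigner_scale)
      (has_mean_signed_entry i a b))).
apply: has_mean_eq (h) _ _ => // {h}.
rewrite (bigD1 a0)//= (bigD1 a0)//= !eqxx/= mul0r mulr0 add0r.
under eq_bigr => b bb do rewrite (negbTE bb)/= mul1r /test_weight eqxx (negbTE bb).
rewrite sum_neq_const.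
under eq_bigr => a aa.
  rewrite (bigD1 a0)//= big1 => [|b bb].
    rewrite (negbTE aa) eqxx/= mul1r addr0 /test_weight (negbTE aa) eqxx.
    over.
  by rewrite (negbTE aa) (negbTE bb)/= mul0r mulr0.
rewrite sum_neq_const -/al -/be /y; ring.
Qed.

End wigner_blocks.

(** * The contradiction *)

Section lower_bound.
Context {R : realType} d (T : measurableType d) (P : probability T R).

(** No measurability is required: the integral of a nonnegative function is a
    supremum over the simple functions below it. *)
Lemma ge0_le_integral_dominated (f1 f2 : T -> \bar R) : (forall x, 0 <= f1 x)%E ->
  (forall x, f1 x <= f2 x)%E -> (\int[P]_x f1 x <= \int[P]_x f2 x)%E.
Proof.
move=> f10 f12; rewrite !ge0_integralTE//; last first.
  by move=> x; exact: le_trans (f10 x) (f12 x).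
apply: ereal_sup_le => _ [h /= hf <-].
by exists h => // x; exact: le_trans (hf x) (f12 x).
Qed.

Lemma le_expectation_has_mean (q f : T -> R) c : has_mean P q c ->
  (forall w, 0 <= f w) -> (forall w, q w <= f w) -> (c%:E <= 'E_P[f])%E.
Proof.
move=> [iq eq] f0 qf; rewrite -eq unlock.
apply: (@le_trans _ _ (\int[P]_w (fun w => (q w)%:E)^\+ w)%E).
  apply: le_integral => //; first exact: integrable_funepos.
  by move=> w _; rewrite funeposE le_max lexx.
apply: ge0_le_integral_dominated => w; first exact: funepos_ge0.
by rewrite funeposE ge_max !lee_fin qf f0.
Qed.

End lower_bound.

Theorem proposition8p2 (R : realType) (sigmass : mx_functional R) (C beta : R)
    (hparam : matrix_parameter sigmass) (hC : 0 < C) (hbeta : 0 < beta)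
    (hbound : forall (d : nat) (disp : measure_display)
       (T : measurableType disp) (P : probability T R) (X : T -> 'M[R[i]]_d),
       (0 < d)%N -> centered_gaussian_mx P X ->
       ('E_P[fun w => opnorm (X w)] <=
          (C * mx_sigma P X
           + C * sigmass d disp T P X * (ln (d%:R : R)) `^ beta)%:E)%E)
    (C' : R) :
  ~ [/\ (* (1) *)
        forall (d : nat) (disp : measure_display) (T : measurableType disp)
          (P : probability T R) (X1 X2 : T -> 'M[R[i]]_d),
          (0 < d)%N -> centered_jointly_gaussian_mx P X1 X2 ->
          sigmass d disp T P (fun w => X1 w + X2 w) <=
            C' * (sigmass d disp T P X1 + sigmass d disp T P X2),
        (* (2) *)
        forall (d : nat) (disp : measure_display) (T : measurableType disp)
          (P : probability T R) (X : T -> 'M[R[i]]_d) (U : 'M[R[i]]_d),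
          (0 < d)%N -> centered_gaussian_mx P X -> U \is unitarymx ->
          sigmass d disp T P (fun w => U^t* *m X w *m U) <=
            C' * sigmass d disp T P X,
        (* (3) *)
        forall (d : nat) (disp : measure_display) (T : measurableType disp)
          (P : probability T R) (X : T -> 'M[R[i]]_d) (N : nat),
          (0 < d)%N -> (0 < N)%N -> centered_gaussian_mx P X ->
          sigmass (d * N)%N disp T P (fun w => X w *t (1%:M : 'M[R[i]]_N)) <=
            C' * sigmass d disp T P X
      & (* (4) *)
        forall (disp : nat -> measure_display)
          (T : forall N, measurableType (disp N))
          (P : forall N, probability (T N) R)
          (G : forall N, T N -> 'M[R[i]]_N),
          (forall N, (0 < N)%N -> standard_wigner (P N) (G N)) ->
          (fun N => sigmass N (disp N) (T N) (P N) (G N)) =o_\oo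
            (fun N => (ln (N%:R : R)) `^ (- beta))].
Proof.
move=> [h1 h2 h3 h4].
(* As the parameter is nonnegative on Gaussian matrices, (1)-(3) hold with the
   constant |C'| too; C' itself may be negative. *)
pose D : R := `|C'|.
have D0 : 0 <= D by exact: normr_ge0.
have sge0 := hparam.1.
have leD (a : R) : 0 <= a -> C' * a <= D * a.
  by move=> a0; rewrite ler_wpM2r// ler_norm.
have s1 (d : nat) (disp : measure_display) (T : measurableType disp)
    (P : probability T R) (X1 X2 : T -> 'M[R[i]]_d) : (0 < d)%N ->
    centered_jointly_gaussian_mx P X1 X2 ->
    sigmass d disp T P (fun w => X1 w + X2 w) <=
      D * (sigmass d disp T P X1 + sigmass d disp T P X2).
  move=> d0 X12; apply: le_trans (h1 _ _ _ _ _ _ d0 X12) (leD _ _).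
  case: X12 => n [g [A1 [A2 [gi e1 e2]]]].
  by apply: addr_ge0; apply: sge0 => //; exists n, g; [exists A1|exists A2].
have s2 (d : nat) (disp : measure_display) (T : measurableType disp)
    (P : probability T R) (X : T -> 'M[R[i]]_d) (U : 'M[R[i]]_d) : (0 < d)%N ->
    centered_gaussian_mx P X -> U \is unitarymx ->
    sigmass d disp T P (fun w => U^t* *m X w *m U) <= D * sigmass d disp T P X.
  move=> d0 cX uU; apply: le_trans (h2 _ _ _ _ _ _ d0 cX uU) (leD _ _).
  exact: sge0.
have s3 (d : nat) (disp : measure_display) (T : measurableType disp)
    (P : probability T R) (X : T -> 'M[R[i]]_d) (N : nat) : (0 < d)%N -> (0 < N)%N ->
    centered_gaussian_mx P X ->
    sigmass (d * N)%N disp T P (fun w => X w *t (1%:M : 'M[R[i]]_N)) <=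
      D * sigmass d disp T P X.
  move=> d0 N0 cX; apply: le_trans (h3 _ _ _ _ _ _ d0 N0 cX) (leD _ _).
  exact: sge0.
(* The number of tensor factors is m + 1 = q ^ 2, with q so large that
   q ^ 2 (kappa / 2) > C sqrt v q + 1.  The left-hand side will be a lower bound
   of the expected norm and the right-hand side an upper bound. *)
pose kappa : R := normal_abs_mean; have kappa0 : 0 < kappa := normal_abs_mean_gt0.
pose v : R := normal_variance; have v0 : 0 <= v := normal_variance_ge0.
pose q : nat := (Num.truncn ((C * Num.sqrt v + 1) * 2 / kappa)).+1.
have qbig : (C * Num.sqrt v + 1) * 2 / kappa < q%:R by exact: truncnS_gt.
pose m : nat := (q ^ 2).-1.
have mE : m.+1 = (q ^ 2)%N by rewrite /m prednK// expn_gt0.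
pose sp N := @gaussian_space R (block_size m N).
pose T N := projT1 (projT2 (sp N)).
pose P N : probability (T N) R := projT1 (projT2 (projT2 (sp N))).
pose g N : 'I_(block_size m N) -> T N -> R := sval (projT2 (projT2 (projT2 (sp N)))).
have gP N : (forall i, measurable_fun setT (g N i)) /\ product_rule (P N) (g N).
  exact: svalP (projT2 (projT2 (projT2 (sp N)))).
have iid N : iid_standard_gaussian (P N) (g N).
  by have [mg pg] := gP N; exact: product_rule_iid.
pose K : R := tower_cst D m.
have K0 : 0 <= K.
  rewrite /K; elim: (m) => [|k IH] //=.
  by rewrite addr_ge0 ?mulr_ge0 ?exprn_ge0.
pose M : R := m.+1%:R.
(* This eps makes the second term of the assumed bound at most 1. *)
pose eps : R := (C * K * M `^ beta + 1)^-1.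
have CK0 : 0 <= C * K * M `^ beta by rewrite !mulr_ge0 ?powR_ge0// ltW.
have eps0 : 0 < eps by rewrite invr_gt0 ltr_wpDl.
have near_small : \forall N \near \oo, forall i : 'I_m.+1,
    `|sigmass N _ (T N) (P N) (wigner_block (g N) i)| <=
      eps * `|(ln (N%:R : R)) `^ (- beta)|.
  apply: filter_forall => i.
  have := h4 _ T P (fun N => wigner_block (g N) i)
    (fun N N0 => standard_wigner_block i N0 (iid N)).
  by move=> /eqoP/(_ eps eps0).
have [N [N1 small]] : exists N, (1 < N)%N /\ forall i : 'I_m.+1,
    `|sigmass N _ (T N) (P N) (wigner_block (g N) i)| <=
      eps * `|(ln (N%:R : R)) `^ (- beta)|.
  case: near_small => N0 _ h; exists (maxn N0 2); split; first by rewrite leq_max orbT.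
  by apply: h; rewrite /= leq_maxl.
have N0 : (0 < N)%N := ltnW N1.
pose L : R := ln (N%:R : R).
have L0 : 0 < L by rewrite ln_gt0// ltr1n.
pose delta : R := eps * L `^ (- beta).
have Bdelta i : (i < m.+1)%N -> sigmass N _ (T N) (P N) (wigner_block (g N) i) <= delta.
  move=> im; rewrite (le_trans (ler_norm _))// (le_trans (small (Ordinal im)))//.
  by rewrite ger0_norm ?powR_ge0.
have [d [A [dE [Ah _] A2 As Aq]]] := tensor_tower D0 s1 s2 s3 (iid N) N0
  (@wigner_coef_herm R m N) (fun i _ => @wigner_coef_sqr R m N i)
  (fun i j l (h : (i < j < m.+1)%N) => @wigner_coef_disjoint R m N i j l h)
  Bdelta (ltnSn m).
have d0 : (0 < d)%N by rewrite dE expn_gt0 N0.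
have [mg pg] := gP N.
have a0 : 'I_N := Ordinal N0.
have [y y2 my] : exists2 y : R, 2^-1 <= y & forall i : nat,
    has_mean (P N) (test_value (g N) a0 i) (y * normal_abs_mean).
  exact: test_value_mean.
have lower : ((M * (y * kappa))%:E <=
    'E_(P N)[fun w => opnorm (gaussian_series (g N) A w)])%E.
  have hm : has_mean (P N) (fun w => \sum_(i < m.+1) test_value (g N) a0 i w)
      (M * (y * kappa)).
    have -> : M * (y * kappa) = \sum_(i < m.+1) (y * kappa).
      by rewrite sumr_const card_ord -[RHS]mulr_natl.
    by apply: has_mean_sum => i _; exact: my.
  apply: le_expectation_has_mean hm _ _ => w; first exact: opnorm_ge0.
  have [x x1 xq] := Aq w (fun i => test_vector (g N) a0 i w)
    (fun i => test_value (g N) a0 i w)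
    (fun i => test_vector_unit (g N) a0 N1 i w) (fun i => test_valueE (g N) a0 i w).
  exact: opnorm_ge_quadratic_form x1 xq.
have sig : mx_sigma (P N) (gaussian_series (g N) A) <= Num.sqrt (v * M).
  apply: mx_sigma_gaussian_series => //.
  by move=> k l; exact: has_mean_mul pg k l.
have upper := hbound d _ (T N) (P N) (gaussian_series (g N) A) d0
  (ex_intro _ _ (ex_intro _ _ (ex_intro _ A (conj (iid N) erefl)))).
have {lower upper} := le_trans lower upper.
rewrite lee_fin => main.
have lnd : ln (d%:R : R) `^ beta = M `^ beta * L `^ beta.
  by rewrite dE natrX lnXn ?ltr0n// -[ln _ *+ _]mulr_natl powRM ?(ltW L0).
have bound2 : C * sigmass d _ (T N) (P N) (gaussian_series (g N) A) *
    ln (d%:R : R) `^ beta <= 1.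
  rewrite lnd; apply: (@le_trans _ _ (C * (K * delta) * (M `^ beta * L `^ beta))).
    by rewrite ler_wpM2r ?mulr_ge0 ?powR_ge0// ler_wpM2l// ltW.
  have -> : C * (K * delta) * (M `^ beta * L `^ beta) = C * K * M `^ beta * eps.
    rewrite /delta powRN; have : L `^ beta != 0 by rewrite gt_eqF// powR_gt0.
    by move: (L `^ beta) => z z0; field.
  by rewrite /eps ler_pdivrMr ?ltr_wpDl// mul1r lerDl.
have sq : Num.sqrt (v * M) = Num.sqrt v * q%:R.
  by rewrite sqrtrM// /M mE natrX sqrtr_sqr ger0_norm.
rewrite sq in sig.
have q1 : 1 <= (q%:R : R) by rewrite ler1n.
have Mq : M = q%:R ^+ 2 by rewrite /M mE natrX.
have b1 : C * mx_sigma (P N) (gaussian_series (g N) A) <= C * (Num.sqrt v * q%:R).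
  by rewrite ler_wpM2l// ltW.
have b0 : q%:R ^+ 2 * (2^-1 * kappa) <= M * (y * kappa).
  by rewrite Mq ler_wpM2l ?sqr_ge0// ler_wpM2r// ltW.
have b3 : (C * Num.sqrt v + 1) * q%:R < q%:R ^+ 2 * (2^-1 * kappa).
  rewrite expr2 -mulrA [ltRHS]mulrC -mulrA [_ * kappa]mulrC.
  rewrite ltr_pdivrMr// in qbig.
  rewrite mulrC; nra.
have b4 : C * (Num.sqrt v * q%:R) + 1 <= (C * Num.sqrt v + 1) * q%:R by nra.
lra.
Qed.
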